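(* Let $\mathcal{X}$ be a real linear space with $\dim\mathcal{X}=n$, and let $\mathcal{L}\subset\mathcal{X}\times\mathcal{X}^*$ be a Lagrangian subspace with kernel representation $$\mathcal{L}=\{(x,e)\in\mathcal{X}\times\mathcal{X}^*\mid S^Tx-P^Te=0\}$$ for real $n\times n$ matrices $P,S$ satisfying $S^TP=P^TS$ and $\operatorname{rank}\begin{bmatrix} S^T & P^T\end{bmatrix}=n$. Suppose $\operatorname{rank}P=m\le n$. Then there exist an $m$-dimensional sub-vector $x_1$ of $x\in\mathcal{X}$ and a complementary $(n-m)$-dimensional sub-vector $e_2$ of $e\in\mathcal{X}^*$ such that $\mathcal{L}$ is represented as $$\mathcal{L}=\Big\{(x,e)\in\mathcal{X}\times\mathcal{X}^*\;\Big|\; \begin{bmatrix} e_1\\ x_2\end{bmatrix}=\widehat{Q}\begin{bmatrix} x_1\\ e_2\end{bmatrix}\Big\}$$ for some real $n\times n$ matrix $\widehat{Q}$ with $$\widehat{Q}^T\begin{bmatrix} I_m&0\\0&-I_{n-m}\end{bmatrix}=\begin{bmatrix} I_m&0\\0&-I_{n-m}\end{bmatrix}\widehat{Q}.$$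
   Context: $\mathcal{X}$ is a finite-dimensional real linear space with dual $\mathcal{X}^*$, and $\langle e\mid x\rangle$ denotes the duality product between $x\in\mathcal{X}$ and $e\in\mathcal{X}^*$. Elements of $\mathcal{X}$ and $\mathcal{X}^*$ are identified with column vectors in $\mathbb{R}^n$ by means of a basis of $\mathcal{X}$ and its dual basis, so that $\langle e\mid x\rangle=e^Tx$. On $\mathcal{X}\times\mathcal{X}^*$ consider the bilinear form $$\langle (x_1,e_1),(x_2,e_2)\rangle_- := \langle e_1\mid x_2\rangle-\langle e_2\mid x_1\rangle.$$ A Lagrangian subspace is a subspace $\mathcal{L}\subset\mathcal{X}\times\mathcal{X}^*$ that equals its own orthogonal companion with respect to $\langle\cdot,\cdot\rangle_-$, i.e. $\mathcal{L}=\{v\in\mathcal{X}\times\mathcal{X}^*\mid \langle v,w\rangle_-=0 \text{ for all } w\in\mathcal{L}\}$. Sub-vectors: for an index set $I\subset\{1,\dots,n\}$ with $|I|=m$ and complement $I^c$, the sub-vectors $x_1,e_1\in\mathbb{R}^m$ consist of the components of $x$, respectively $e$, with index in $I$, and the sub-vectors $x_2,e_2\in\mathbb{R}^{n-m}$ consist of the components of $x$, respectively $e$, with index in $I^c$. The existence claim is that such an index set $I$ (the same for $x$ and $e$) can be chosen. *)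

(* Defs.v *)
From mathcomp Require Import all_boot all_order all_algebra.
From mathcomp Require Import reals.

Set Implicit Arguments.
Unset Strict Implicit.
Unset Printing Implicit Defensive.

Import GRing.Theory.
Local Open Scope ring_scope.

(* The duality product <e | x> is the application e x. *)
Definition minus_form (R : realType) (X : vectType R)
    (v w : X * 'Hom(X, R^o)) : R :=
  v.2 w.1 - w.2 v.1.

Definition lagrangian (R : realType) (X : vectType R)
    (L : {vspace X * 'Hom(X, R^o)}) : Prop :=
  forall v, v \in L <-> (forall w, w \in L -> minus_form v w = 0).

Definition coords (R : realType) (X : vectType R) (n : nat) (b : n.-tuple X)
    (x : X) : 'cV[R]_n :=
  \col_i coord b i x.

(* The i-th coordinate of e in the dual basis of b is the value e b_i. *)
Definition dual_coords (R : realType) (X : vectType R) (n : nat)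
    (b : n.-tuple X) (e : 'Hom(X, R^o)) : 'cV[R]_n :=
  \col_i e (tnth b i).

(* The components with index in I are listed in increasing order of index;
   the proof of #|I| = m only serves to give the result the type 'cV_m. *)
Definition subvec (R : realType) (n : nat) (I : {set 'I_n}) (m : nat)
    (hI : #|I| = m) (v : 'cV[R]_n) : 'cV[R]_m :=
  \col_k v (enum_val (cast_ord (esym hI) k)) 0.

(* A matrix of size m + (n - m) is an n x n matrix whenever m <= n; the size is
   written this way so that the block decomposition typechecks. *)
Definition signature_mx (R : realType) (n m : nat) : 'M[R]_(m + (n - m)) :=
  block_mx 1%:M 0 0 (- 1%:M).

(* Main.v *)
(** Let [I] index [m] independent rows of [P], and write [P_I], [S_I] for the
    rows indexed by [I] and [P_J], [S_J] for the others.  With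
    [M = (P_I; S_J)], [N = (S_I; P_J)] and [Sg = diag(1, -1)], the kernel
    equation [S^T x = P^T e] reads [M^T Sg (e_1; x_2) = N^T Sg (x_1; e_2)], and
    [S^T P = P^T S] reads [M^T Sg N = N^T Sg M].  The matrix [M] is invertible:
    if [M z = 0], then [P z = 0] because the rows of [P_I] span those of [P];
    hence [0 = P^T S z = P_I^T S_I z], so [S_I z = 0] by independence.  Thus
    [S z = 0] and [z = 0] by the rank condition.  Therefore
    [Q = Sg M^-T N^T Sg], and its symmetry reduces to that of [M^T Sg N]. *)
Require Import Defs.
From mathcomp Require Import all_boot all_order all_algebra.
From mathcomp Require Import reals.

Set Implicit Arguments.
Unset Strict Implicit.
Unset Printing Implicit Defensive.

Import GRing.Theory.
Local Open Scope ring_scope.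

Section IndexSplitting.

Variables (F : fieldType) (n : nat).
Implicit Types I : {set 'I_n}.

Definition rows_in I m (hI : #|I| = m) p (A : 'M[F]_(n, p)) : 'M[F]_(m, p) :=
  rowsub (fun k => enum_val (cast_ord (esym hI) k)) A.

Lemma mulmx_rows_in I m k (hI : #|I| = m) (hIc : #|~: I| = k) p q
    (A : 'M[F]_(n, p)) (B : 'M[F]_(n, q)) :
  (rows_in hI A)^T *m rows_in hI B + (rows_in hIc A)^T *m rows_in hIc B
  = A^T *m B.
Proof.
case: m / hI; case: k / hIc; apply/matrixP => i j; rewrite !mxE.
under eq_bigr do rewrite !mxE cast_ord_id.
under [X in _ + X]eq_bigr do rewrite !mxE cast_ord_id.
rewrite -(big_enum_val (fun l => A l i * B l j)).
rewrite -(big_enum_val (fun l => A l i * B l j)).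
rewrite [RHS](bigID (mem I)) /=; congr (_ + _).
  by apply: eq_bigr => l _; rewrite mxE.
by apply: eq_big => [l|l _]; rewrite ?inE // mxE.
Qed.

(** The image of [maxrankfun P] serves as [I]. Listing it in increasing order only permutes the
    selected rows, so they still span [P]; being [\rank P] in number, they are independent. *)
Lemma rows_in_independent p (P : 'M[F]_(n, p)) :
  exists I (hI : #|I| = \rank P),
    row_free (rows_in hI P) /\ (P <= rows_in hI P)%MS.
Proof.
pose f := maxrankfun P.
have hI : #|[set f k | k in 'I_(\rank P)]| = \rank P.
  by rewrite card_imset ?card_ord //; apply: maxrankfun_inj.
exists [set f k | k in 'I_(\rank P)], hI.
have sP : (P <= rows_in hI P)%MS.
  rewrite -(eq_maxrowsub P); apply/row_subP => k.
  have fk : f k \in [set f k | k in 'I_(\rank P)] by apply: imset_f.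
  rewrite row_rowsub.
  have -> : row (f k) P
    = row (cast_ord hI (enum_rank_in fk (f k))) (rows_in hI P).
    by rewrite row_rowsub cast_ordK enum_rankK_in.
  exact: row_sub.
split=> //; rewrite /row_free eqn_leq rank_leq_row /=.
exact: mxrankS sP.
Qed.

Lemma row_free_mixed_rows I m k (hI : #|I| = m) (hIc : #|~: I| = k)
    (P S : 'M[F]_n) :
  S^T *m P = P^T *m S -> row_free (row_mx S^T P^T) ->
  row_free (rows_in hI P) -> (P <= rows_in hI P)%MS ->
  row_free (col_mx (rows_in hI P) (rows_in hIc S))^T.
Proof.
move=> hSP hfree freeP /submxP[C PE]; apply/inj_row_free => z.
rewrite tr_col_mx mul_mx_row -row_mx0 => /eq_row_mx[zP zS].
have zPT : z *m P^T = 0 by rewrite PE trmx_mul mulmxA zP mul0mx.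
have zSI : z *m (rows_in hI S)^T = 0.
  apply: (row_free_inj freeP); rewrite mul0mx -mulmxA.
  have := congr1 (mulmx z) (mulmx_rows_in hI hIc S P).
  by rewrite hSP mulmxDr !mulmxA zS zPT !mul0mx addr0.
have zST : z *m S^T = 0.
  (* Splitting [S^T *m 1%:M] along [I] recovers [z *m S^T] from its two vanishing parts. *)
  have := congr1 (mulmx z) (mulmx_rows_in hI hIc S 1%:M).
  by rewrite mulmxDr !mulmxA zS zSI !mul0mx addr0 mulmx1 => <-.
by apply: (row_free_inj hfree); rewrite mul_mx_row zST zPT row_mx0 mul0mx.
Qed.

End IndexSplitting.

(** The sizes [n] and [m + (n - m)] are only provably equal, so [invmx] does not apply directly to
    the mixed matrix; with variables for sizes the equation can be eliminated. *)
Lemma row_free_two_sided_inverse (F : fieldType) p q (A : 'M[F]_(p, q)) :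
  p = q -> row_free A -> exists W, W *m A = 1%:M /\ A *m W = 1%:M.
Proof.
move=> pq; case: q / pq A => A; rewrite row_free_unit => uA.
by exists (invmx A); rewrite mulVmx ?mulmxV.
Qed.

Lemma subvecE (R : realType) n (I : {set 'I_n}) m (hI : #|I| = m)
    (v : 'cV[R]_n) : subvec hI v = rows_in hI v.
Proof. by apply/matrixP => i j; rewrite !mxE (ord1 j). Qed.

Section Signature.

Variables (R : realType) (n m : nat).
Local Notation Sg := (signature_mx R n m).

Lemma signature_mxK : Sg *m Sg = 1%:M.
Proof.
rewrite mulmx_block !mulmx0 !mul0mx !addr0 !add0r mulmx1 mulmxN mulNmx opprK.
by rewrite mulmx1 -scalar_mx_block.
Qed.

Lemma tr_signature_mx : Sg^T = Sg.
Proof. by rewrite tr_block_mx !trmx0 linearN /= !trmx1. Qed.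

Lemma mul_tr_signature_mx p q (A : 'M[R]_(m, p)) (B : 'M[R]_(n - m, p))
    (C : 'M[R]_(m, q)) (D : 'M[R]_(n - m, q)) :
  (col_mx A B)^T *m Sg *m col_mx C D = A^T *m C - B^T *m D.
Proof.
rewrite -mulmxA mul_block_col !mul1mx !mul0mx addr0 add0r mulNmx mul1mx.
by rewrite tr_col_mx mul_row_col mulmxN.
Qed.

End Signature.

Theorem proposition5p2 (R : realType) (n : nat) (X : vectType R)
    (hdim : \dim {:X} = n)
    (b : n.-tuple X) (hb : basis_of {:X} b)
    (L : {vspace X * 'Hom(X, R^o)}) (hL : lagrangian L)
    (P S : 'M[R]_n)
    (hSP : S^T *m P = P^T *m S)
    (hrank : \rank (row_mx S^T P^T) = n)
    (hker : forall (x : X) (e : 'Hom(X, R^o)),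
       (x, e) \in L <->
         S^T *m coords b x - P^T *m dual_coords b e = 0)
    (m : nat) (hm : \rank P = m) (hmn : (m <= n)%N) :
  exists (I : {set 'I_n}) (hI : #|I| = m) (hIc : #|~: I| = (n - m)%N)
         (Q : 'M[R]_(m + (n - m))),
    (forall (x : X) (e : 'Hom(X, R^o)),
       (x, e) \in L <->
         col_mx (subvec hI (dual_coords b e)) (subvec hIc (coords b x))
         = Q *m col_mx (subvec hI (coords b x)) (subvec hIc (dual_coords b e)))
    /\ Q^T *m signature_mx R n m = signature_mx R n m *m Q.
Proof.
move: m hm hmn => _ <- hmn.
pose m := \rank P.
have [I [hI [freeP sP]]] := rows_in_independent P.
have hIc : #|~: I| = (n - m)%N by rewrite cardsCs setCK card_ord hI.
have hfree : row_free (row_mx S^T P^T) by apply/eqP.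
have [W [WM MW]] := row_free_two_sided_inverse (esym (subnKC hmn))
  (row_free_mixed_rows hIc hSP hfree freeP sP).
set M := col_mx _ _ in WM MW; set Sg := signature_mx R n m.
pose N := col_mx (rows_in hI S) (rows_in hIc P).
have SgK := @signature_mxK R n m; rewrite -/Sg in SgK.
have SgT := @tr_signature_mx R n m; rewrite -/Sg in SgT.
exists I, hI, hIc, (Sg *m W *m N^T *m Sg); split=> [x e|].
  rewrite hker !subvecE.
  set u := coords b x; set v := dual_coords b e.
  set y := col_mx _ _; set w := col_mx _ _.
  (* The right side is (S_I^T x_1 - P_J^T e_2) - (P_I^T e_1 - S_J^T x_2). *)
  have -> : S^T *m u - P^T *m v = N^T *m Sg *m w - M^T *m Sg *m y.
    rewrite !mul_tr_signature_mx -(mulmx_rows_in hI hIc S u).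
    rewrite -(mulmx_rows_in hI hIc P v) opprD opprB addrACA.
    by rewrite -!addrA; congr (_ + _); rewrite [LHS]addrC addrAC addrC.
  split=> [/eqP|->].
    rewrite subr_eq0 => /eqP hw.
    by rewrite -!mulmxA (mulmxA N^T) hw !mulmxA -(mulmxA Sg) WM mulmx1 SgK
               mul1mx.
  by rewrite !mulmxA -(mulmxA M^T Sg) SgK mulmx1 MW mul1mx subrr.
(* Moving the subtracted [~: I] terms across turns this into S^T P = P^T S. *)
have sym : N^T *m Sg *m M = M^T *m Sg *m N.
  rewrite !mul_tr_signature_mx; apply/eqP; rewrite subr_eq addrAC eq_sym subr_eq.
  by rewrite !mulmx_rows_in hSP.
have MWT : M *m W^T = 1%:M by rewrite -(trmxK M) -trmx_mul WM trmx1.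
rewrite !trmx_mul trmxK SgT !mulmxA SgK mul1mx -!mulmxA SgK mulmx1.
(* What remains is Sg N W^T = W N^T Sg. Inserting W M^T on the left and M W^T on the right exhibits
   both sides of [sym] between W and W^T. *)
rewrite -[LHS]mul1mx -WM -[RHS]mulmx1 -MWT !mulmxA.
by rewrite -!mulmxA; congr (W *m _); rewrite !mulmxA -sym.
Qed.
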